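(* Let $\kappa$ be a cardinal with $2<\kappa<\mathfrak c$ and $2^\kappa\le\mathfrak c$. Then there exists a partition $\{B_\xi:\xi<\kappa\}$ of $\mathbb R$ such that (1) every $B_\xi$ is a Bernstein set, (2) no $B_\xi$ is a $2$-covering, and (3) $\{B_\xi:\xi<\kappa\}$ is a $\kappa$-S-covering.
   Context: $\mathfrak c=|\mathbb R|$. A set $B\subseteq\mathbb R$ is a Bernstein set if for every uncountable Borel $Z\subseteq\mathbb R$ both $Z\cap B$ and $Z\setminus B$ are nonempty. A set $A$ is a $2$-covering if every $C\subseteq\mathbb R$ with $|C|=2$ has a translate $C+x\subseteq A$. A family $\mathcal A$ of pairwise disjoint subsets of $\mathbb R$ is a $\kappa$-S-covering if $|\mathcal A|=\kappa$ and for every $F\subseteq\mathbb R$ with $|F|=\kappa$ there is $t\in\mathbb R$ such that $F+t\subseteq\bigcup\mathcal A$ and $|(F+t)\cap A|=1$ for every $A\in\mathcal A$. *)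

(* Defs.v *)
From HB Require Import structures.
From mathcomp Require Import all_boot all_order all_algebra.
From mathcomp Require Import all_classical all_reals all_analysis.
Set Implicit Arguments. Unset Strict Implicit. Unset Printing Implicit Defensive.
Import Order.TTheory GRing.Theory Num.Theory.
Import numFieldTopology.Exports.
Local Open Scope classical_set_scope.
Local Open Scope ring_scope.

Definition borel (R : realType) (Z : set R) : Prop := <<s @open R >> Z.

Definition bernstein (R : realType) (B : set R) : Prop :=
  forall Z : set R, borel Z -> ~ countable Z ->
    (Z `&` B) !=set0 /\ (Z `\` B) !=set0.

Definition two_covering (R : realType) (A : set R) : Prop :=
  forall C : set R, (C #= [set: bool])%card ->
    exists x : R, [set c + x | c in C] `<=` A.

Definition kappa_S_covering (R : realType) (K : Type) (A : K -> set R) : Prop :=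
  (forall i j, i <> j -> A i `&` A j = set0) /\
  (range A #= [set: K])%card /\
  forall F : set R, (F #= [set: K])%card ->
    exists t : R,
      [set x + t | x in F] `<=` \bigcup_(i in [set: K]) A i /\
      forall i, exists y : R, [set x + t | x in F] `&` A i = [set y].

(* Main.v *)
Require Import Defs.
From HB Require Import structures.
From mathcomp Require Import all_boot all_order all_algebra.
From mathcomp Require Import all_classical all_reals all_analysis.
From mathcomp Require Import wochoice lra.
Set Implicit Arguments.
Unset Strict Implicit.
Unset Printing Implicit Defensive.
Import Order.TTheory GRing.Theory Num.Theory.
Local Open Scope classical_set_scope.
Local Open Scope ring_scope.

(* We colour R with the elements of K so that x and x + 1 never share a colour;
   then no colour class contains a translate of {0, 1}. There are continuum many
   requirements, since Borel sets are analytic and c^kappa = (2^kappa)^omega = c: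
   "the uncountable Borel set Z contains a point of colour k" and "some translate
   of the injective family f : K -> R has f k + t of colour k for every k". They
   are met one after the other along a well-order whose proper initial segments
   have fewer than c elements. Each asks for a translation t in a set of size c
   (by the perfect set theorem in the first case), and fewer than c values of t
   bring the new points to distance 0 or 1 from those already coloured. The
   remaining points are coloured greedily, which is possible because a point has
   only two neighbours x - 1 and x + 1 while there are at least three colours. *)

(** * Comparing cardinalities by injections *)

Definition embeds (A B : Type) := exists f : A -> B, injective f.

Lemma card_leT_embeds (A B : Type) : ([set: A] #<= [set: B])%card -> embeds A B.
Proof.
move=> /card_leP[f].
have fI : injective f by move=> u v; apply: 'inj_f; rewrite inE.
exists (fun x => val (f (SigSub (mem_set (I : [set: A] x))))) => x y.
by move=> /val_inj/fI/(congr1 val).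
Qed.

Lemma embeds_card_leT (A : Type) (B : pointedType) :
  embeds A B -> ([set: A] #<= [set: B])%card.
Proof. by move=> [f fI]; apply/pcard_injP; exists f => x y _ _; apply: fI. Qed.

Lemma embeds_trans (A B C : Type) : embeds A B -> embeds B C -> embeds A C.
Proof.
by move=> [f fI] [g gI]; exists (g \o f); apply: inj_comp.
Qed.

Lemma embeds_fun (X A B : Type) : embeds A B -> embeds (X -> A) (X -> B).
Proof.
move=> [f fI]; exists (fun u x => f (u x)) => u v /funeqP uv.
by apply/funext => x; apply/fI/uv.
Qed.

Lemma embeds_countable_bool (C : countType) : embeds (C -> bool) (nat -> bool).
Proof.
exists (fun u n => oapp u false (unpickle n)) => u v /funeqP uv.
by apply/funext => x; have := uv (pickle x); rewrite pickleK.
Qed.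

(** * Choice, well-founded recursion and small initial segments *)

Lemma inj_retraction (A B : Type) (f : A -> B) (a0 : A) :
  injective f -> exists g, cancel f g.
Proof.
move=> fI; have /choice[g gP] : forall b, exists a, forall a', f a' = b -> a = a'.
  move=> b; have [[a <-]|nb] := pselect (exists a, f a = b).
    by exists a => a' /fI.
  by exists a0 => a' fb; case: nb; exists a'.
by exists g => a; apply: gP.
Qed.

(** [P x g b] means that [b] is admissible at [x] given the values [g]. By the last hypothesis only
    values below [x] matter, so filling up with [b0] elsewhere is harmless. *)
Lemma wf_choice (S B : Type) (lt : S -> S -> Prop) (b0 : B)
    (P : S -> (S -> B) -> B -> Prop) :
  well_founded lt ->
  (forall x g, exists b, P x g b) ->
  (forall x g g' b, (forall y, lt y x -> g y = g' y) -> P x g b -> P x g' b) ->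
  exists g, forall x, P x g (g x).
Proof.
move=> wf ex loc.
have /choice[F FP] : forall xg : S * (S -> B), exists b, P xg.1 xg.2 b.
  by move=> [x g]; apply: ex.
pose ext x (g : forall y, lt y x -> B) y :=
  if pselect (lt y x) is left h then g y h else b0.
pose step x g := F (x, ext x g).
exists (Fix wf (fun=> B) step) => x.
rewrite Fix_eq; last first.
  move=> y g g' gg'; congr (F (_, _)); apply/funext => z.
  by rewrite /ext; case: pselect.
apply: loc (FP (x, _)) => y yx /=.
by rewrite /ext; case: pselect.
Qed.

Lemma wf_linear_order (T : eqType) : exists lt : T -> T -> Prop,
  [/\ well_founded lt, forall x y, x <> y -> lt x y \/ lt y x &
      forall x y z, lt x y -> lt y z -> lt x z].
Proof.
have [le le_wo] := well_ordering_principle T.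
have minP (A : pred T) : (exists x, x \in A) ->
    exists2 x, x \in A & forall y, y \in A -> le x y.
  by move=> /le_wo[x [[xA xmin] _]]; exists x.
have anti x y : le x y -> le y x -> x = y.
  move=> xy yx; have lec : wo_chain le predT by move=> A _; apply: le_wo.
  by apply: (wo_chain_antisymmetric lec) => //; rewrite xy yx.
(* Transitivity follows by asking which of the three points is the least. *)
have trans x y z : le x y -> le y z -> le x z.
  move=> xy yz; have [|m] := minP (pred3 x y z).
    by exists x; rewrite !inE eqxx.
  rewrite !inE => /or3P[] /eqP -> mmin.
  - by apply: mmin; rewrite !inE eqxx !orbT.
  - by rewrite (anti x y xy) //; apply: mmin; rewrite !inE eqxx.
  - by rewrite -(anti y z yz) //; apply: mmin; rewrite !inE eqxx !orbT.
exists (fun x y => le x y /\ x <> y); split.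
- move=> x; apply: contrapT => nx.
  have [|z zN zm] := minP [pred x | `[< ~ Acc (fun x y => le x y /\ x <> y) x >]].
    by exists x; apply/asboolP.
  move: zN => /asboolP; apply; constructor=> y [yz nyz].
  apply: contrapT => ny; apply: nyz; apply: anti => //.
  by apply: zm; apply/asboolP.
- move=> x y nxy; have [|z] := minP (pred2 x y).
    by exists x; rewrite !inE eqxx.
  rewrite !inE => /orP[] /eqP -> zm; [left|right].
    by split=> //; apply: zm; rewrite !inE eqxx orbT.
  by split; [apply: zm; rewrite !inE eqxx|move/esym].
- move=> x y z [xy nxy] [yz nyz]; split; first exact: trans xy yz.
  by move=> xz; apply: nxy; apply: anti => //; rewrite xz.
Qed.

(* By choice, this says |Y| < |R| when R is inhabited. *)
Definition small (R Y : Type) := ~ exists g : Y -> R, forall r, exists y, g y = r.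

Lemma small_surj (R X Y : Type) (h : X -> Y) :
  small R X -> (forall y, exists x, h x = y) -> small R Y.
Proof.
move=> sX hs [g gs]; apply: sX; exists (g \o h) => r.
have [y <-] := gs r; have [x <-] := hs y; by exists x.
Qed.

(* Koenig's diagonal argument: at each x, the function d avoids the fewer than |R|
   values taken there by the functions indexed by the pairs (x, y). *)
Lemma small_prod (R X Y : Type) (r0 : R) :
  embeds (X -> R) R -> small R Y -> small R (X * Y).
Proof.
move=> [f /(inj_retraction (fun=> r0))[h fK]] sY [g gs].
have /choice[d dP] : forall x, exists r, forall y, h (g (x, y)) x <> r.
  move=> x; apply: contrapT => nx; apply: sY.
  exists (fun y => h (g (x, y)) x) => r; apply: contrapT => nr.
  by apply: nx; exists r => y yr; apply: nr; exists y.
by have [[x y] gxy] := gs (f d); apply: (dP x y); rewrite gxy fK.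
Qed.

(** If some initial segment of a well-order of [R] maps onto [R], cutting at the least such point
    leaves an order that plays the role of the initial ordinal of [R]. *)
Lemma small_segments (R : eqType) : exists (S : Type) (lt : S -> S -> Prop),
  [/\ well_founded lt, forall x y, x <> y -> lt x y \/ lt y x,
      forall x, small R {y | lt y x} &
      exists f : S -> R, forall r, exists s, f s = r].
Proof.
have [lt [wf tot trl]] := wf_linear_order R.
have [alls|/existsNP[x0 x0P]] := pselect (forall x, small R {y | lt y x}).
  by exists R, lt; split=> //; exists id => r; exists r.
have {x0P x0}[x x_big xmin] : exists2 x, ~ small R {y | lt y x} &
    forall z, lt z x -> small R {y | lt y z}.
  elim/(well_founded_ind wf): x0 x0P => x IH xb.
  have [xm|/existsNP[z /not_implyP[zx zb]]] :=
    pselect (forall z, lt z x -> small R {y | lt y z}); first by exists x.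
  exact: IH z zx zb.
exists {y | lt y x}, (fun y z => lt (sval y) (sval z)); split.
- move=> [y yx]; elim/(well_founded_ind wf): y yx => y IH yx.
  by constructor=> -[z zx] /= zy; exact: IH.
- move=> [y yx] [z zx] nyz; apply: tot => /= yz; apply: nyz.
  by subst z; congr exist; apply: Prop_irrelevance.
- move=> [z zx] /=; pose h (w : {y | lt y z}) : {s : {y | lt y x} | lt (sval s) z} :=
    exist _ (exist _ (sval w) (trl _ _ _ (svalP w) zx)) (svalP w).
  apply: (small_surj (h := h) (xmin z zx)).
  move=> [[y yx] yz]; exists (exist _ y yz).
  by apply: eq_exist; apply: eq_exist.
- exact: contrapT.
Qed.

(** * Cardinal arithmetic of powers *)

(** In cardinals, [R^X <= (2^N)^X = (2^X)^N <= R^N <= (2^N)^N = 2^(N x N) = 2^N <= R]. *)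
Lemma embeds_power (X R : Type) :
  embeds (X -> bool) R -> embeds R (nat -> bool) -> embeds (nat -> bool) R ->
  embeds (X -> R) R.
Proof.
move=> XR Rnat natR.
have swap : embeds (X -> nat -> bool) (nat -> X -> bool).
  exists (fun u n x => u x n) => u v uv; apply/funext => x; apply/funext => n.
  exact: (congr1 (fun w => w n x) uv).
have curry : embeds (nat -> nat -> bool) (nat * nat -> bool).
  exists (fun u p => u p.1 p.2) => u v /funeqP uv.
  by apply/funext => m; apply/funext => n; apply: (uv (m, n)).
apply: embeds_trans (embeds_fun X Rnat) _; apply: embeds_trans swap _.
apply: embeds_trans (embeds_fun nat XR) _.
apply: embeds_trans (embeds_fun nat Rnat) _; apply: embeds_trans curry _.
exact: embeds_trans (embeds_countable_bool _) natR.
Qed.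

Lemma embeds_pair (A B R : Type) :
  embeds A R -> embeds B R -> embeds (nat -> R) R -> embeds (A * B) R.
Proof.
move=> [f fI] [g gI]; apply: embeds_trans.
exists (fun p n => if n is 0%N then f p.1 else g p.2) => -[a b] [a' b'].
by move=> /funeqP uv; congr (_, _); [apply/fI/(uv 0%N)|apply/gI/(uv 1%N)].
Qed.

(** * Analytic sets of reals *)

Section Analytic.
Variable R : realType.
Implicit Types (x : R) (y : nat -> nat) (C : R -> (nat -> nat) -> Prop).

(* Openness in R x N^N, where N^N carries the product topology. *)
Definition opn C := forall x y, C x y -> exists e n, 0 < e /\
  forall x' y', `|x' - x| < e -> (forall i, (i < n)%N -> y' i = y i) -> C x' y'.

(** The projection of a closed subset of R x N^N, given by its open complement [C]. *)
Definition analytic (A : set R) :=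
  exists C, opn C /\ A = [set x | exists y, ~ C x y].

Lemma opn_reindex (g : nat -> nat) C :
  opn C -> opn (fun x y => C x (y \o g)).
Proof.
(* The first [n] terms of [y \o g] involve only terms of [y] with index below this maximum. *)
move=> oC x y /oC[e [n [e0 eC]]]; exists e, (\max_(i < n) (g i).+1)%N.
split=> // x' y' xx' yy'; apply: eC => // i ltin /=; apply: yy'.
exact: (@leq_bigmax _ (fun i : 'I_n => (g i).+1) (Ordinal ltin)).
Qed.

Lemma opn_exists (I : Type) (C : I -> R -> (nat -> nat) -> Prop) :
  (forall i, opn (C i)) -> opn (fun x y => exists i, C i x y).
Proof.
move=> oC x y [i /oC[e [n [e0 eC]]]]; exists e, n; split=> // x' y' xx' yy'.
by exists i; apply: eC.
Qed.

(** The first term of [y] selects a member of the union; the remaining terms are a witness for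
    it. *)
Lemma analytic_bigcup (A : nat -> set R) :
  (forall i, analytic (A i)) -> analytic (\bigcup_i A i).
Proof.
move=> /choice[C CP]; exists (fun x y => C (y 0%N) x (y \o succn)); split.
  move=> x y Cxy; have [/opn_reindex/(_ _ _ Cxy)[e [n [e0 eC]]] _] := CP (y 0%N).
  exists e, n.+1; split=> // x' y' xx' yy'; rewrite yy'//.
  by apply: eC => // i ltin; apply: yy'; rewrite ltnS ltnW.
apply/seteqP; split=> [x [i _]|x [y nC]]; last first.
  by exists (y 0%N) => //; rewrite (CP _).2; exists (y \o succn).
rewrite (CP i).2 => -[y Cy]; exists (fun n => if n is m.+1 then y m else i).
by rewrite [X in C _ _ X](_ : _ = y).
Qed.

(** One sequence stores a witness for every [A i], at the positions [pickle (i, n)]. *)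
Lemma analytic_bigcap (A : nat -> set R) :
  (forall i, analytic (A i)) -> analytic (\bigcap_i A i).
Proof.
move=> /choice[C CP].
exists (fun x y => exists i, C i x (y \o (fun n => pickle (i, n)))); split.
  by apply: opn_exists => i; apply: opn_reindex; apply: (CP i).1.
apply/seteqP; split=> [x Ax|x [y nC] i _]; last first.
  rewrite (CP i).2; exists (y \o (fun n => pickle (i, n))) => Ci.
  by apply: nC; exists i.
have /choice[y yP] : forall i, exists y, ~ C i x y.
  by move=> i; have := Ax i I; rewrite {1}(CP i).2.
exists (fun m => if unpickle m is Some (i, n) then y i n else 0%N) => -[i].
suff -> : (fun m => if unpickle m is Some (i, n) then y i n else 0%N) \o
  (fun n => pickle (i, n)) = y i by apply: yP.
by apply/funext => n /=; rewrite pickleK.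
Qed.

Lemma analytic_closed (F : set R) :
  (forall x, ~ F x -> exists2 e, 0 < e & forall x', `|x' - x| < e -> ~ F x') ->
  analytic F.
Proof.
move=> cF; exists (fun x _ => ~ F x); split=> [x y /cF[e e0 eF]|].
  by exists e, 0%N; split=> // x' y' /eF.
apply/seteqP; split=> [x Fx|x [_ /contrapT]//]; by exists id.
Qed.

Lemma analytic_closed_inset (U : set R) (e : R) :
  analytic [set x | forall z, `|z - x| < e -> U z].
Proof.
apply: analytic_closed => x /existsNP[z /not_implyP[zx nUz]].
exists (e - `|z - x|); first by rewrite subr_gt0.
move=> x' x'x /(_ z) xU; apply/nUz/xU; rewrite -(subrKA x) addrC.
by rewrite (le_lt_trans (ler_normD _ _))// distrC -ltrBrDr.
Qed.

(** The sets that are analytic together with their complement form a sigma-algebra containing the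
    open sets. *)
Lemma borel_analytic (Z : set R) : borel Z -> analytic Z.
Proof.
move=> bZ; suff [] : analytic Z /\ analytic (~` Z) by [].
move: Z bZ; apply: smallest_sub.
  split=> [|A [A1 A2]|A /all_and2[A1 A2]].
  - split; apply: analytic_closed => x; first by exists 1 => // x' _ [].
    by rewrite /setC /set0 /= => /(_ id).
  - by rewrite setTD setCK.
  - split; first exact: analytic_bigcup.
    by rewrite setC_bigcup; exact: analytic_bigcap.
move=> U oU; have oUP x : U x -> exists2 e, 0 < e & forall z, `|z - x| < e -> U z.
  move=> Ux; have /nbhs_ballP[e /= e0 eU] := open_nbhs_nbhs (conj oU Ux).
  by exists e => // z zx; apply: eU; rewrite /ball/= distrC.
split; last first.
  apply: analytic_closed => x /contrapT/oUP[e e0 eU]; exists e => //.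
  by move=> x' /eU Ux' /(_ Ux').
(* An open set is a countable union of closed sets. *)
rewrite (_ : U = \bigcup_n [set x | forall z, `|z - x| < n.+1%:R^-1 -> U z]).
  by apply: analytic_bigcup => n; apply: analytic_closed_inset.
apply/seteqP; split=> [x /oUP[e e0 eU]|x [n _]]; last first.
  by apply; rewrite subrr normr0.
have [k] := ltr_add_invr e0; rewrite add0r => ke.
by exists k => // z zx; apply/eU/(lt_trans zx).
Qed.

(** * A countable base of R x N^N and codes for analytic sets *)

Definition box : Type := (rat * rat * seq nat)%type.

Definition in_box (b : box) x y :=
  (ratr b.1.1 < x < ratr b.1.2) /\ mkseq y (size b.2) = b.2.

Lemma opn_in_box b : opn (in_box b).
Proof.
case: b => -[p q] s x y [/= /andP[px xq] ys].
exists (Num.min (x - ratr p) (ratr q - x)), (size s).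
split; first by rewrite lt_min !subr_gt0 px.
move=> x' y'; rewrite lt_min !ltr_distl => /andP[/andP[h1 _] /andP[_ h2]] yy'.
split; first by apply/andP; split; lra.
rewrite -[in RHS]ys; apply/eq_in_map => i; rewrite mem_iota add0n => /yy' //.
Qed.

Lemma box_around x y (e : R) n : 0 < e -> exists b, in_box b x y /\
  forall x' y', in_box b x' y' -> `|x' - x| < e /\ forall i, (i < n)%N -> y' i = y i.
Proof.
move=> e0.
have [p /[!inE] /itvP pP] : exists p, ratr p \in `]x - e, x[.
  by have [|p] := @rat_in_itvoo R (x - e) x; [lra|exists p].
have [q /[!inE] /itvP qP] : exists q, ratr q \in `]x, x + e[.
  by have [|q] := @rat_in_itvoo R x (x + e); [lra|exists q].
exists (p, q, mkseq y n); rewrite /in_box /= size_mkseq; split.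
  by rewrite pP qP.
move=> x' y' [/andP[px xq] yy']; split.
  have h1 : x - e < ratr p by rewrite pP.
  have h2 : ratr q < x + e by rewrite qP.
  by rewrite ltr_distl; apply/andP; split; lra.
move=> i ltin; have /(congr1 (nth 0%N ^~ i)) := yy'.
by rewrite !nth_mkseq.
Qed.

(* Every analytic set is determined by a set of rational boxes, namely those
   missing the closed set that it is the projection of. *)
Definition suslin (P : box -> bool) : set R :=
  [set x | exists y, forall b, P b -> ~ in_box b x y].

Lemma analytic_suslin (A : set R) : analytic A -> exists P, A = suslin P.
Proof.
move=> [C [oC ->]]; exists (fun b => `[< forall x y, in_box b x y -> C x y >]).
apply/seteqP; split=> x [y nC]; exists y.
  by move=> b /asboolP bC /bC.
move=> /oC[e [n [e0 eC]]]; have [b [bxy bP]] := box_around x y n e0.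
apply: (nC b) => //; apply/asboolP => x' y' /bP[xx' yy']; exact: eC.
Qed.

Lemma cauchy_inv_limit (X : nat -> R) :
  (forall m n, (m <= n)%N -> `|X n - X m| <= m.+1%:R^-1) ->
  exists x, forall m, `|x - X m| <= m.+1%:R^-1.
Proof.
move=> cX; pose l := [set X n - n.+1%:R^-1 | n in [set: nat]].
(* Every lower bound [X n - 1/(n+1)] is below every upper bound, so the supremum of the lower bounds
   serves as the limit. *)
have lu m n : X n - n.+1%:R^-1 <= X m + m.+1%:R^-1.
  have := cX m n; have := cX n m; rewrite !ler_distl.
  have : 0 <= m.+1%:R^-1 :> R by [].
  have : 0 <= n.+1%:R^-1 :> R by [].
  move: (n.+1%:R^-1) (m.+1%:R^-1) => u v u0 v0 nm mn.
  by have [/mn|/ltnW/nm] := leqP m n => /andP[]; lra.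
have lsup : has_sup l.
  by split; [exists (X 0%N - 1%:R^-1), 0%N|exists (X 0%N + 1%:R^-1) => _ [n _ <-]].
exists (sup l) => m; rewrite ler_distl; apply/andP; split.
  by apply: ub_le_sup; [case: lsup|exists m].
by apply: ge_sup; [case: lsup|move=> _ [n _ <-]].
Qed.

End Analytic.

(** * The perfect set theorem for analytic sets *)

Section PerfectSet.
Variables (R : realType) (C : R -> (nat -> nat) -> Prop).
Hypothesis oC : opn C.

Let big (b : box) := ~ countable [set x | exists y, in_box b x y /\ ~ C x y].

(* Discarding the countably many points that lie in a box that is not big
   removes only countably many points of B. *)
Let condensation (B : set R) : ~ countable B -> exists x0 x1,
  [/\ x0 <> x1, B x0, B x1 & forall x y b, x = x0 \/ x = x1 ->
      in_box b x y -> ~ C x y -> big b].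
Proof.
move=> ncB.
pose N := \bigcup_(b in [set b | ~ big b]) [set x | exists y, in_box b x y /\ ~ C x y].
have cN : countable N.
  apply: bigcup_countable => [|b /contrapT//].
  exact: (@countableP (rat * rat * seq nat)%type).
have ncBN : ~ countable (B `\` N).
  move=> cBN; apply: ncB; pose F (i : bool) := if i then B `\` N else N.
  apply: (@sub_countable _ _ _ (\bigcup_i F i)).
    apply: subset_card_le => x Bx; have [Nx|Nx] := pselect (N x).
      by exists false.
    by exists true.
  by apply: bigcup_countable => // -[].
have [x0 [Bx0 Nx0]] : (B `\` N) !=set0.
  by apply/set0P/eqP => BN0; apply: ncBN; rewrite BN0.
have [x1 [Bx1 Nx1] x01] : exists2 x1, (B `\` N) x1 & x0 <> x1.
  apply: contrapT => nx; apply: ncBN; apply: (@sub_countable _ _ _ [set x0]) => //.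
  apply: subset_card_le => x BNx; apply: contrapT => xx0.
  by apply: nx; exists x => // x0x; apply: xx0.
exists x0, x1; split=> // x y b xE bxy nCxy; apply: contrapT => nb.
have Nx : N x by exists b => //; exists y.
by case: xE Nx => ->.
Qed.

(** One step of a Cantor scheme. The boxes are separated in the real coordinate, since the resulting
    map into R has to be injective. *)
Let split_pair (n : nat) (b b0 b1 : box) :=
  [/\ big b0, big b1,
      forall (x : R) y, in_box b0 x y \/ in_box b1 x y -> in_box b x y,
      (forall i (x : R) y x' y', i = b0 \/ i = b1 -> in_box i x y -> in_box i x' y' ->
        `|x - x'| <= n.+1%:R^-1 /\ forall j, (j < n)%N -> y j = y' j) &
      exists e : R, 0 < e /\ forall x y x' y', in_box b0 x y -> in_box b1 x' y' ->
        e <= `|x - x'|].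

Let big_split n b : big b -> exists b0 b1, split_pair n b b0 b1.
Proof.
move=> /condensation[x0 [x1 [x01 [y0 [b0 C0]] [y1 [b1 C1]] cond]]].
have [e0 [n0 [e00 E0]]] := opn_in_box b0.
have [e1 [n1 [e10 E1]]] := opn_in_box b1.
(* Radii of at most a quarter of the distance keep the two boxes apart; radii of at most half of
   [1/(n+1)] bound their diameters. *)
pose d := `|x0 - x1| / 4; have d0 : 0 < d.
  by rewrite divr_gt0// normr_gt0 subr_eq0; apply/eqP.
pose e := Num.min (Num.min e0 e1) (Num.min d (n.+1%:R^-1 / 2)).
have e_gt0 : 0 < e by rewrite !lt_min e00 e10 d0 divr_gt0.
have ee0 : e <= e0 by rewrite !ge_min lexx.
have ee1 : e <= e1 by rewrite !ge_min lexx orbT.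
have ed : e <= d by rewrite !ge_min lexx !orbT.
have en : e <= n.+1%:R^-1 / 2 by rewrite !ge_min lexx !orbT.
pose m := maxn n (maxn n0 n1).
have [c0 [c0x c0P]] := box_around x0 y0 m e_gt0.
have [c1 [c1x c1P]] := box_around x1 y1 m e_gt0.
have close c (z : R) w : (forall (x : R) y, in_box c x y -> `|x - z| < e /\
    forall i, (i < m)%N -> y i = w i) -> forall (x : R) y (x' : R) y',
    in_box c x y ->
    in_box c x' y' -> `|x - x'| <= n.+1%:R^-1 /\ forall j, (j < n)%N -> y j = y' j.
  move=> cP x y x' y' /cP[xz yw] /cP[x'z y'w]; split.
    have := le_lt_trans (ler_normD (x - z) (z - x')) _; rewrite subrKA => /(_ (e + e)).
    rewrite (distrC z) ltrD// => /(_ isT)/ltW/le_trans; apply.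
    by move: en; move: (n.+1%:R^-1) (e) => u v; lra.
  move=> j jn; have jm : (j < m)%N by rewrite (leq_trans jn)// leq_maxl.
  by rewrite yw // y'w.
exists c0, c1; split.
- by apply: cond c0x C0; left.
- by apply: cond c1x C1; right.
- move=> x y [/c0P|/c1P] [xx yy].
    apply: E0; first by rewrite (lt_le_trans xx).
    by move=> i i0; apply: yy; rewrite !leq_max i0 orbT.
  apply: E1; first by rewrite (lt_le_trans xx).
  by move=> i i0; apply: yy; rewrite !leq_max i0 !orbT.
- by move=> i x y x' y' [] ->; [exact: (close _ _ _ c0P)|exact: (close _ _ _ c1P)].
- exists d; split=> // x y x' y' /c0P[xx _] /c1P[xx' _].
  have := ler_normD (x0 - x) (x - x1); rewrite subrKA.
  have := ler_normD (x - x') (x' - x1); rewrite subrKA (distrC x0 x).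
  have : `|x0 - x1| = d * 4 by rewrite divfK.
  by move: xx xx' ed; move: (e) => v; lra.
Qed.

(** A binary tree of big boxes shrinks along each branch [f] to a point, which lies outside [C]
    because [C] is open. *)
Lemma perfect_set : ~ countable [set x | exists y, ~ C x y] ->
  exists h : (nat -> bool) -> R, injective h /\ forall f, exists y, ~ C (h f) y.
Proof.
move=> /condensation[x0 [x1 [_ [y0 C0] _ cond]]].
have [b0 [b0x _]] := box_around x0 y0 0 ltr01.
have {cond C0 b0x}big0 : big b0 by apply: cond b0x C0; left.
have /choice[sp spP] : forall nb : nat * box, exists b : box * box,
    big nb.2 -> split_pair nb.1 nb.2 b.1 b.2.
  move=> [n b]; have [/(big_split n)[c0 [c1 cP]]|nb] := pselect (big b).
    by exists (c0, c1).
  by exists (b, b).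
pose D (f : nat -> bool) := fix D n := if n is m.+1 then
  (if f m then (sp (m, D m)).2 else (sp (m, D m)).1) else b0.
have bigD f n : big (D f n).
  by elim: n => //= n /(spP (n, _))[/= ? ? _ _ _]; case: (f n).
have spD f n := spP (n, D f n) (bigD f n).
have subD f m n (x : R) y : (m <= n)%N -> in_box (D f n) x y -> in_box (D f m) x y.
  move=> /subnK <-; elim: (n - m)%N => // k IH H; apply: IH; move: H.
  rewrite addSn /=; have [_ _ /= sub _ _] := spD f (k + m)%N.
  by case: (f _) => H; apply: sub; [right|left].
have diamD f n (x : R) y x' y' : in_box (D f n.+1) x y -> in_box (D f n.+1) x' y' ->
    `|x - x'| <= n.+1%:R^-1 /\ forall j, (j < n)%N -> y j = y' j.
  rewrite /=; have [_ _ _ /= diam _] := spD f n.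
  by case: (f n) => H H'; apply: (diam _ _ _ _ _ _ H H'); [right|left].
have /choice[p pP] : forall fn : (nat -> bool) * nat, exists p : R * (nat -> nat),
    in_box (D fn.1 fn.2.+1) p.1 p.2 /\ ~ C p.1 p.2.
  move=> [f n]; apply: contrapT => np; apply: (bigD f n.+1).
  rewrite (_ : mkset _ = set0)//; apply/seteqP; split=> // x [y xy].
  by apply: np; exists (x, y).
have pD f m n : (m <= n)%N -> in_box (D f m.+1) (p (f, n)).1 (p (f, n)).2.
  by move=> mn; apply: (subD f _ n.+1) => //; exact: (pP (f, n)).1.
have /choice[h hP] : forall f, exists x : R, forall m, `|x - (p (f, m)).1| <= m.+1%:R^-1.
  move=> f; apply: cauchy_inv_limit => m n mn.
  exact: (diamD _ _ _ _ _ _ (pD f m n mn) (pD f m m (leqnn m))).1.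
have inv_small (e : R) n : 0 < e -> exists2 m, (n <= m)%N & m.+1%:R^-1 < e.
  move=> e0; have [k] := ltr_add_invr e0; rewrite add0r => ke.
  exists (maxn n k); first exact: leq_maxl.
  by apply: le_lt_trans ke; rewrite lef_pV2 ?posrE// ler_nat ltnS leq_maxr.
exists h; split; last first.
  (* The shift to [j.+1] matters: coordinate [j] is constant on [D f j.+2], which contains
     [p (f, j.+1)]. *)
  move=> f; exists (fun j => (p (f, j.+1)).2 j) => /oC[e [n [e0 eC]]].
  have [m nm me] := inv_small e n e0.
  apply: (pP (f, m)).2; apply: eC.
    by rewrite distrC (le_lt_trans (hP f m)).
  move=> i ltin; have im := leq_trans ltin nm.
  exact: (diamD _ _ _ _ _ _ (pD f i.+1 m im) (pD f i.+1 i.+1 (leqnn _))).2.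
move=> f g hfg; apply: contrapT => nfg.
have ex : exists n, f n != g n.
  by apply: contrapT => /forallNP fg; apply/nfg/funext => n; apply/eqP/negPn/negP/fg.
case: (ex_minnP ex) => n nfgn nmin.
(* Both branches share their box up to the first differing bit; there the real coordinates split. *)
have Dfg : D f n = D g n.
  have : forall k, (k < n)%N -> f k = g k.
    move=> k kn; apply/eqP; apply: contraTT kn => /nmin; by rewrite -leqNgt.
  by elim: (n) => //= k IH fg; rewrite fg// IH// => j jk; apply: fg; rewrite ltnW.
have [e [e0 sep]] : exists e : R, 0 < e /\ forall x y x' y',
    in_box (D f n.+1) x y -> in_box (D g n.+1) x' y' -> e <= `|x - x'|.
  have [_ _ _ _ /= [e [e0 sep]]] := spD f n.
  exists e; split=> // x y x' y'; rewrite /= -Dfg; move: nfgn.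
  case: (f n) (g n) => -[]// _ H H'; last exact: sep H H'.
  by rewrite distrC; exact: sep H' H.
have e20 : 0 < e / 2 by rewrite divr_gt0.
have [m nm me] := inv_small (e / 2) n e20.
have := sep _ _ _ _ (pD f n m nm) (pD g n m nm).
have := ler_normD ((p (f, m)).1 - h f) (h f - (p (g, m)).1); rewrite subrKA.
have := hP f m; have := hP g m; rewrite hfg (distrC _ (h g)); move: me.
by move: (m.+1%:R^-1) => u; lra.
Qed.

End PerfectSet.

(** * The real line and Cantor space *)

(** Countable sets are Lebesgue null, but the unit interval has measure 1. *)
Lemma uncountable_real (R : realType) : ~ countable [set: R].
Proof.
move=> cR; have : lebesgue_measure `[0%R, 1%R]%classic = 0%E :> \bar R.
  apply: countable_lebesgue_measure0; apply: sub_countable cR.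
  exact: subset_card_le.
rewrite lebesgue_measure_itv/= lte_fin ltr01 sube0 => /eqP.
by rewrite eqe oner_eq0.
Qed.

(** A real is determined by the rationals below it. *)
Lemma embeds_real_cantor (R : realType) : embeds R (nat -> bool).
Proof.
apply: embeds_trans (embeds_countable_bool rat).
exists (fun x q => ratr q < x) => x y /funeqP xy.
have le (u v : R) : (forall q : rat, (ratr q < u) = (ratr q < v)) -> u <= v.
  move=> uv; rewrite leNgt; apply/negP => /rat_in_itvoo[q].
  by rewrite in_itv/= uv => /andP[/lt_trans h /h]; rewrite ltxx.
by apply/eqP; rewrite eq_le !le// => q; rewrite xy.
Qed.

Lemma borel_cantor (R : realType) (Z : set R) : borel Z -> ~ countable Z ->
  exists2 h : (nat -> bool) -> R, injective h & forall f, Z (h f).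
Proof.
move=> /borel_analytic[C [oC ->]] /(perfect_set oC)[h [hI hC]].
by exists h.
Qed.

Lemma borel_setT (R : realType) : borel [set: R].
Proof. by apply: sub_sigma_algebra; exact: openT. Qed.

Lemma embeds_cantor_real (R : realType) : embeds (nat -> bool) R.
Proof.
have [|h hI _] := borel_cantor _ (@uncountable_real R); last by exists h.
exact: borel_setT.
Qed.

(** * Separated translates and proper colourings *)

(** At stage [s] the forbidden translations are indexed by a product of N, two copies of [K] and the
    earlier stages, too small a set to exhaust the copy of Cantor space in [Z s]. *)
Lemma translates_apart (R : realType) (K S : Type) (lt : S -> S -> Prop)
    (Z : S -> set R) (F : S -> K -> R) :
  well_founded lt -> (forall x y, x <> y -> lt x y \/ lt y x) ->
  (forall x, small R {y | lt y x}) -> embeds (K -> R) R ->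
  (forall s, exists2 h : (nat -> bool) -> R, injective h & forall f, Z s (h f)) ->
  exists t : S -> R, (forall s, Z s (t s)) /\
    forall s s' k k', s <> s' ->
      F s k + t s <> F s' k' + t s' /\ F s k + t s <> F s' k' + t s' + 1.
Proof.
move=> wf tot sml KR Zbig.
have natR : embeds (nat -> R) R.
  exact: embeds_power (embeds_cantor_real R) (embeds_real_cantor R)
    (embeds_cantor_real R).
(* Forbidding the offsets -1, 0, 1, 2, ... keeps F s k + t s away from the earlier
   points and from their translates by 1 and -1. *)
pose ok s (g : S -> R) t := Z s t /\ forall s' k k' n, lt s' s ->
  F s k + t <> F s' k' + g s' + n%:R - 1.
have [t tP] : exists t : S -> R, forall s, ok s t (t s).
  apply: (wf_choice 0 wf) => [s g|s g g' b gg' [Zb gP]]; last first.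
    by split=> // s' k k' n s's; rewrite -gg'//; exact: gP.
  apply: contrapT => nok.
  have [h hI Zh] := Zbig s; have [u uI] := embeds_real_cantor R.
  have [v hK] := inj_retraction (0 : R) (inj_comp hI uI).
  have sm := small_prod (0 : R) natR (small_prod (0 : R) KR
    (small_prod (0 : R) KR (sml s))).
  (* If no translation were admissible, every [h (u r)] would be forbidden, and [v] would map the
     index set onto R. *)
  apply: sm; exists (fun p =>
    v (F (sval p.2.2.2) p.2.2.1 + g (sval p.2.2.2) + p.1%:R - 1 - F s p.2.1)).
  move=> r; apply: contrapT => nr; apply: nok; exists (h (u r)); split=> //.
  move=> s' k k' n s's e; apply: nr.
  exists (n, (k, (k', exist _ s' s's))) => /=.
  by rewrite -e (addrC (F s k)) addrK hK.
exists t; split=> [s|s s' k k' /tot[ss'|s's]]; first exact: (tP s).1.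
  have [_ /(_ s k' k)] := tP s' => {}tP; split=> e.
    by apply: (tP 1%N) => //; rewrite e addrK.
  by apply: (tP 0%N) => //; rewrite e addr0 addrK.
have [_ /(_ s' k k')] := tP s => {}tP; split=> e.
  by apply: (tP 1%N) => //; rewrite e addrK.
by apply: (tP 2%N) => //; rewrite e; lra.
Qed.

Lemma extend_coloring (R : realType) (K : Type) (k0 : K) (G : R -> K -> Prop) :
  (forall a b : K, exists c, c <> a /\ c <> b) ->
  (forall x k k', G x k -> G x k' -> k = k') ->
  (forall x k, G x k -> ~ G (x + 1) k) ->
  exists c : R -> K, (forall x k, G x k -> c x = k) /\ forall x, c x <> c (x + 1).
Proof.
move=> third Gfun Gprop; have [lt [wf tot _]] := wf_linear_order R.
(* The colour of a neighbour z of x that is settled before that of x. *)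
pose seen x (g : R -> K) z k :=
  G z k \/ [/\ forall k', ~ G z k', lt z x & k = g z].
(* Prescribed colours are kept. Any other point avoids its prescribed neighbours, wherever they
   stand in the well-order, and its earlier unprescribed ones. *)
pose ok x g k := (forall k', G x k' -> k = k') /\ ((forall k', ~ G x k') ->
  forall z k', z = x + 1 \/ x = z + 1 -> seen x g z k' -> k <> k').
have [c cP] : exists c : R -> K, forall x, ok x c (c x).
  apply: (wf_choice k0 wf) => [x g|x g g' k gg' [kG kn]]; last first.
    split=> // nG z k' zx s'; apply: (kn nG z) => //.
    by case: s' => [|[nz zlt ->]]; [left|right; rewrite gg'].
  have [[k Gk]|/forallNP nG] := pselect (exists k, G x k).
    by exists k; split=> [k'|/(_ k)//]; exact: Gfun.
  have seen1 z : exists a, forall k, seen x g z k -> k = a.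
    have [[a Ga]|/forallNP nGz] := pselect (exists k, G z k).
      by exists a => k [/Gfun/(_ Ga)//|[/(_ a)]].
    by exists (g z) => k [/nGz//|[]].
  have [a aP] := seen1 (x + 1); have [b bP] := seen1 (x - 1).
  have [k [ka kb]] := third a b; exists k; split=> [k' /nG//|_ z k'].
  move=> [->/aP ->//|xz]; have -> : z = x - 1 by rewrite xz addrK.
  by move=> /bP ->.
exists c; split=> x => [k /((cP x).1 k)//|cx].
have [c1 c2] := cP x; have [c3 c4] := cP (x + 1).
have [[k Gk]|/forallNP nG] := pselect (exists k, G x k);
    have [[k' Gk']|/forallNP nG'] := pselect (exists k, G (x + 1) k).
- by apply: (Gprop x k Gk); rewrite -(c1 _ Gk) cx (c3 _ Gk').
- by apply: (c4 nG' x k); [right|left|rewrite -cx; exact: c1].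
- by apply: (c2 nG (x + 1) k'); [left|left|rewrite cx; exact: c3].
(* Of two unprescribed neighbours, the later one has seen the colour of the earlier. *)
have : x <> x + 1 by lra.
move=> /tot[lx|lx].
  by apply: (c4 nG' x (c x)) => //; [right|right].
by apply: (c2 nG (x + 1) (c (x + 1))) => //; [left|right].
Qed.

(** * Construction of the partition *)

(** Were there nothing besides [a] and [b], the test for equality with [a] would embed [K] into
    [bool]. *)
Lemma third_element (K : Type) : ~ embeds K bool ->
  forall a b : K, exists c, c <> a /\ c <> b.
Proof.
move=> nK a b; apply: contrapT => nc; apply: nK.
have ab c : c <> a -> c = b.
  by move=> ca; apply: contrapT => cb; apply: nc; exists c.
exists (fun c => `[< c = a >]) => c d cd.
have [ca|ca] := pselect (c = a).
  by rewrite ca; apply/esym/asboolP; rewrite -cd; apply/asboolP.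
rewrite (ab c ca); apply/esym/ab => da; apply: ca.
by apply/asboolP; rewrite cd; apply/asboolP.
Qed.

Theorem mainTheorem10 (R : realType) (K : Type) :
  (* 2 < kappa *)
  ~ ([set: K] #<= [set: bool])%card ->
  (* kappa < c *)
  ([set: K] #<= [set: R])%card -> ~ ([set: R] #<= [set: K])%card ->
  (* 2^kappa <= c *)
  ([set: K -> bool] #<= [set: R])%card ->
  exists B : K -> set R,
    (* partition of R *)
    (forall i j, i <> j -> B i `&` B j = set0) /\
    \bigcup_(i in [set: K]) B i = [set: R] /\
    (forall i, B i !=set0) /\
    (forall i, bernstein (B i)) /\
    (forall i, ~ two_covering (B i)) /\
    kappa_S_covering B.
Proof.
move=> K3 /card_leT_embeds KR _ /card_leT_embeds pKR.
have {}K3 : ~ embeds K bool by move=> /embeds_card_leT.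
have third := third_element K3.
have [k0] : exists k0 : K, True.
  apply: contrapT => nK; apply: K3.
  by exists (fun=> true) => k; case: nK; exists k.
have cR := embeds_cantor_real R; have Rc := embeds_real_cantor R.
have natR := embeds_power cR Rc cR; have KRR := embeds_power pKR Rc cR.
(* A requirement (P, (f, l)): some translate f k + t with t in [suslin P] gets the
   colour l k for all k. Bernstein requirements have f = 0 and l constant. *)
pose valid (p : (box -> bool) * ((K -> R) * (K -> K))) :=
  (exists2 h : (nat -> bool) -> R, injective h & forall f, suslin p.1 (h f)) /\
  forall k k', p.2.1 k = p.2.1 k' <-> p.2.2 k = p.2.2 k'.
have valid_const P k : (exists2 h : (nat -> bool) -> R, injective h &
    forall f, suslin P (h f)) -> valid (P, (fun=> 0, fun=> k)) by [].
have borelT := @borel_setT R.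
have [PT PTE] := analytic_suslin (borel_analytic borelT).
have PTbig := borel_cantor borelT (@uncountable_real R); rewrite {}PTE in PTbig.
have [e eI] : embeds {p | valid p} R.
  apply: (@embeds_trans _ ((box -> bool) * ((K -> R) * (K -> K)))).
    by exists sval => -[p vp] [q vq] /= pq; apply: eq_exist.
  apply: embeds_pair => //.
    exact: (embeds_trans (embeds_countable_bool (rat * rat * seq nat)%type)).
  by apply: embeds_pair => //; exact: embeds_trans (embeds_fun K KR) KRR.
(* The retraction takes a valid requirement as default value, so [task] composed with a map from [S]
   onto R enumerates exactly the valid requirements. *)
have [task taskK] := inj_retraction
  (exist valid _ (valid_const PT k0 PTbig)) eI.
have [S [lt [wf tot sml [f fS]]]] := small_segments R.
pose T s := sval (task (f s)).
have T_onto p : valid p -> exists s, T s = p.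
  by move=> vp; have [s fs] := fS (e (exist _ p vp)); exists s; rewrite /T fs taskK.
have [t [tZ tap]] := translates_apart (Z := fun s => suslin (T s).1)
  (fun s => (T s).2.1) wf tot sml KRR (fun s => (svalP (task (f s))).1).
pose G x k := exists s j, x = (T s).2.1 j + t s /\ k = (T s).2.2 j.
have TP s k k' : (T s).2.1 k = (T s).2.1 k' <-> (T s).2.2 k = (T s).2.2 k'.
  exact: (svalP (task (f s))).2.
have [|x k|c [cG cprop]] := extend_coloring k0 (G := G) third.
(* Within one translate, equal points have equal labels; translates of different stages are
   disjoint. *)
- move=> x k k' [s [j [xE ->]]] [s' [j' [xE' ->]]].
  have [ss|/(@tap s s' j j')[]] := pselect (s = s'); last by rewrite -xE -xE'.
  by subst s'; apply/TP; apply: (addIr (t s)); rewrite -xE -xE'.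
(* Within one translate, equal labels mean equal points, which [x] and [x + 1] are not; across
   stages the difference 1 is excluded. *)
- move=> [s [j [xE kE]]] [s' [j' [xE' kE']]].
  have [ss|/nesym/(@tap s' s j' j)[]] := pselect (s = s'); last by rewrite -xE -xE'.
  subst s'; have /TP jj : (T s).2.2 j = (T s).2.2 j' by rewrite -kE -kE'.
  have : x = x + 1 by rewrite {1}xE jj -xE'.
  by lra.
(* For the zero family with constant label [k], the translate is the single point [t s], which lies
   in [Z]. *)
have hit (Z : set R) k : borel Z -> ~ countable Z -> exists2 z, Z z & c z = k.
  move=> bZ ncZ; have := borel_cantor bZ ncZ.
  have [P ->] := analytic_suslin (borel_analytic bZ) => Zbig.
  have [s sE] := T_onto _ (valid_const P k Zbig).
  exists (t s); first by have := tZ s; rewrite sE.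
  by apply: cG; exists s, k; rewrite sE add0r.
pose B k := [set x | c x = k].
have Bdisj i j : i <> j -> B i `&` B j = set0.
  by move=> ij; apply/seteqP; split=> // x [xi xj]; apply: ij; rewrite -xi.
have Bne i : B i !=set0.
  by have [z _ zi] := hit _ i borelT (@uncountable_real R); exists z.
have Bcover : \bigcup_(i in [set: K]) B i = [set: R].
  by apply/seteqP; split=> // x _; exists (c x).
exists B; do 3 split=> //; split; [|split; [|split; [|split]]] => //.
- move=> i Z bZ ncZ; split.
    by have [z Zz zi] := hit Z i bZ ncZ; exists z.
  (* A point of [Z] with another colour [j] lies outside the class of [i]. *)
  have [j [ji _]] := third i i.
  by have [z Zz zj] := hit Z j bZ ncZ; exists z; split=> //; rewrite /B /= zj.
- move=> i /(_ (range (fun b : bool => if b then 1 else 0)))[].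
    by apply: inj_card_eq => -[] [] // _ _ /eqP; rewrite ?oner_eq0// eq_sym oner_eq0.
  move=> x xB; apply: (cprop x).
  have -> : c x = i by apply: xB; exists 0; [exists false|rewrite add0r].
  by apply/esym/xB; exists 1; [exists true|rewrite addrC].
- apply: inj_card_eq => i j _ _ Bij; apply: contrapT => /Bdisj.
  by rewrite Bij setIid => Bj0; have [x] := Bne j; rewrite Bj0.
- move=> F /card_esym/card_bijP[w [v wK vK]].
  pose u k := val (w (SigSub (mem_set (I : [set: K] k)))).
  have uI : injective u by move=> k k' /val_inj/(can_inj wK)/(congr1 val).
  have uF x : F x <-> exists k, u k = x.
    split=> [/mem_set Fx|[k <-]]; last exact/set_mem/valP.
    exists (val (v (SigSub Fx))); rewrite /u.
    by rewrite [X in w X](_ : _ = v (SigSub Fx)) ?vK//; apply: val_inj.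
  (* Labelling [u k] by [k] itself makes the translate of [F] meet each class exactly once. *)
  have [|s sE] := T_onto (PT, (u, id)).
    by split=> //= k k'; split=> [/uI|->].
  have cu k : c (u k + t s) = k by apply: cG; exists s, k; rewrite sE.
  exists (t s); rewrite Bcover; split=> // i; exists (u i + t s).
  apply/seteqP; split=> [_ [[x /uF[k <-] <-]]|_ ->].
    by rewrite /B /= cu => ->.
  by split; [exists (u i) => //; apply/uF; exists i|exact: cu].
Qed.
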